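(* The limit of the derivative $\Gamma_{\mathbb{H}^2}'$ as $x$ goes to $0$ is given by $$\lim_{x\to 0^+}\Gamma_{\mathbb{H}^2}'(x)=\frac{\sqrt{2}-1}{\sqrt{2}}.$$
   Context: $\mathbb{H}^2$ is the hyperbolic plane: the complete, simply connected Riemannian surface of constant curvature $-1$, viewed as a metric space with its geodesic distance. A quadruple $\square=\{a,b,c,d\}$ in a metric space $(X,d)$ is a choice of four (not necessarily distinct) points of $X$. Its three pairwise distance sums are $d(a,b)+d(c,d)$, $d(a,c)+d(b,d)$, $d(a,d)+d(b,c)$; label them so that $S\le M\le L$, and set $\delta(\square)=\frac{L-M}{2}$. The diameter $D(\square)$ is the largest distance between two points of $\square$. Let $\mathrm{Dist}_X=\{d(a,b):a,b\in X\}\subset[0,\infty)$, and define $\Gamma_X:\mathrm{Dist}_X\to\mathbb{R}$ by $$\Gamma_X(x)=\sup_{\square\subset X:\,D(\square)=x}\delta(\square).$$ For $X=\mathbb{H}^2$, $\mathrm{Dist}_X=[0,\infty)$, and $\Gamma_{\mathbb{H}^2}'$ denotes the derivative of $\Gamma_{\mathbb{H}^2}$ on $(0,\infty)$. *)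

(* Defs.v *)
From Stdlib Require Import Reals.
From Coquelicot Require Import Coquelicot.
Open Scope R_scope.

(** ** Quadruples in a space [X] with distance [d] *)

Section FourPoints.

Context {X : Type} (d : X -> X -> R).

(** The median of three reals: if [s <= m <= l] is a sorted labelling of the
    arguments, this is [m]. *)
Definition middle (r s t : R) : R := Rmax (Rmin r s) (Rmin (Rmax r s) t).

Definition delta4 (a b c e : X) : R :=
  let s1 := d a b + d c e in
  let s2 := d a c + d b e in
  let s3 := d a e + d b c in
  (Rmax (Rmax s1 s2) s3 - middle s1 s2 s3) / 2.

Definition diam4 (a b c e : X) : R :=
  Rmax (Rmax (Rmax (d a b) (d a c)) (d a e))
       (Rmax (Rmax (d b c) (d b e)) (d c e)).

(** [Gamma x] is meant for [x] in the set of distances of [X], where the set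
    below is nonempty and bounded (by [x]); elsewhere its value is a dummy. *)
Definition Gamma (x : R) : R :=
  real (Lub_Rbar (fun r => exists a b c e : X,
    diam4 a b c e = x /\ r = delta4 a b c e)).

End FourPoints.

(** ** The hyperbolic plane

    The complete simply connected surface of constant curvature -1, unique up to
    isometry, is realized as the upper half-plane with the Riemannian metric
    [(dx^2 + dy^2) / y^2]. *)

Record H2 : Type := mkH2 { re : R; im : R; im_pos : 0 < im }.

(** Only the restriction of [g] to [[0, 1]] matters: every [C^1] curve on
    [[0, 1]] extends to a [C^1] curve on a neighbourhood, so requiring two-sided
    derivatives at the endpoints loses nothing.  As the speed is allowed to
    vanish, piecewise [C^1] curves can be reparametrized to [C^1] ones of the same
    length, and hence give the same infimum. *)
Definition C1_path (g : R -> H2) (p q : H2) : Prop :=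
  g 0 = p /\ g 1 = q /\
  forall t, 0 <= t <= 1 ->
    (ex_derive (fun u => re (g u)) t /\ ex_derive (fun u => im (g u)) t) /\
    (continuous (Derive (fun u => re (g u))) t /\
     continuous (Derive (fun u => im (g u))) t).

Definition hyp_length (g : R -> H2) : R :=
  RInt (fun t => sqrt ((Derive (fun u => re (g u)) t) ^ 2 +
                       (Derive (fun u => im (g u)) t) ^ 2) / im (g t)) 0 1.

(** The geodesic (Riemannian) distance. *)
Definition hyp_dist (p q : H2) : R :=
  real (Glb_Rbar (fun l => exists g : R -> H2,
    C1_path g p q /\ l = hyp_length g)).

(* Main.v *)
Require Import Defs.
From Stdlib Require Import Reals.
From Coquelicot Require Import Coquelicot.
From Stdlib Require Import Lra Psatz ProofIrrelevance.
Open Scope R_scope.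

(** The function [Gamma] of the hyperbolic plane is explicit: the optimal
    quadruple of diameter [x] is the regular quadrilateral with diagonals [x].
    Its diagonals cross at right angles at their midpoints, so by the hyperbolic
    Pythagorean theorem its side [s] satisfies [cosh s = cosh (x / 2) ^ 2], i.e.
    [sinh (s / 2) = sinh (x / 2) / sqrt 2], and hence
      [Gamma x = x - s = x - 2 * arcsinh (sinh (x / 2) / sqrt 2)]
    ([Gamma_hyp_dist]).  Differentiating, and letting [x] tend to [0], gives
    the limit [1 - 1 / sqrt 2].

    Optimality rests on the inequality [cosh_ptolemy],
      [2 cosh (ac / 2) cosh (bd / 2) <= cosh ((ab + cd) / 2) + cosh ((bc + ad) / 2)].
    In the upper half-plane the Euclidean distances [|z - w|] and [|z - w^*|]
    ([w^*] the complex conjugate) are [sinh (d / 2)] and [cosh (d / 2)] up to a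
    factor that splits as a product over the two points.  Ptolemy's inequality
    in the complex plane, applied to [a, b, c^*, d^*] and to [a, b^*, c^*, d],
    therefore bounds [cosh (ac / 2) cosh (bd / 2)] in two ways, and the addition
    formula for [cosh] turns the sum of the two bounds into the claim.
    Consequently, if [M] is the larger of the two other distance sums, then
    [cosh (ac / 2) cosh (bd / 2) <= cosh (M / 2)].  This inequality persists
    when a diagonal and [M] grow by the same amount ([cosh_mul_cosh_shift]), so
    both diagonals may be lengthened to [x] without changing [ac + bd - M];
    for two diagonals [x] it says exactly that [M >= 2 s] ([gap_le]).

    The distance itself is an infimum of lengths; its closed formula
    [hyp_dist_spec] comes from calibrations.  For each complete geodesic there is
    a function of gradient norm at most [1] that restricts to arc length along it; it
    bounds the length of every path from below, while the geodesic itself attains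
    the bound ([hyp_dist_calibrated]). *)

(** * Hyperbolic functions *)

Lemma exp_mul_exp_opp (x : R) : exp x * exp (- x) = 1.
Proof. rewrite <- exp_plus, Rplus_opp_r; apply exp_0. Qed.

Lemma cosh_sq (x : R) : cosh x ^ 2 = 1 + sinh x ^ 2.
Proof.
unfold cosh, sinh; rewrite <- (exp_mul_exp_opp x); field.
Qed.

Lemma cosh_ge_1 (x : R) : 1 <= cosh x.
Proof.
pose proof (exp_ineq1_le x); pose proof (exp_ineq1_le (- x)); unfold cosh; lra.
Qed.

Lemma cosh_pos (x : R) : 0 < cosh x.
Proof. pose proof (cosh_ge_1 x); lra. Qed.

Lemma cosh_add (x y : R) : cosh (x + y) = cosh x * cosh y + sinh x * sinh y.
Proof. unfold cosh, sinh; rewrite Ropp_plus_distr, !exp_plus; field. Qed.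

Lemma sinh_opp (x : R) : sinh (- x) = - sinh x.
Proof. unfold sinh; rewrite Ropp_involutive; field. Qed.

Lemma cosh_opp (x : R) : cosh (- x) = cosh x.
Proof. unfold cosh; rewrite Ropp_involutive; field. Qed.

Lemma cosh_abs (x : R) : cosh (Rabs x) = cosh x.
Proof. unfold Rabs; destruct (Rcase_abs x); [apply cosh_opp | reflexivity]. Qed.

Lemma cosh_double_cosh (x : R) : cosh x = 2 * cosh (x / 2) ^ 2 - 1.
Proof.
replace x with (x / 2 + x / 2) at 1 by field.
rewrite cosh_add; pose proof (cosh_sq (x / 2)); nra.
Qed.

Lemma cosh_double_sinh (x : R) : cosh x = 1 + 2 * sinh (x / 2) ^ 2.
Proof. rewrite cosh_double_cosh, cosh_sq; ring. Qed.

Lemma sinh_nonneg (x : R) : 0 <= x -> 0 <= sinh x.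
Proof.
intros [H | <-]; [| rewrite sinh_0; lra].
apply sinh_lt in H; rewrite sinh_0 in H; lra.
Qed.

Lemma cosh_lt (x y : R) : 0 <= x -> x < y -> cosh x < cosh y.
Proof.
intros Hx Hxy.
pose proof (sinh_lt x y Hxy); pose proof (sinh_nonneg x Hx).
pose proof (cosh_sq x); pose proof (cosh_sq y).
pose proof (cosh_ge_1 x); pose proof (cosh_ge_1 y); nra.
Qed.

Lemma cosh_le (x y : R) : 0 <= x -> x <= y -> cosh x <= cosh y.
Proof. intros Hx [H | <-]; [left; now apply cosh_lt | right; reflexivity]. Qed.

Lemma cosh_le_inv (x y : R) : 0 <= y -> cosh x <= cosh y -> x <= y.
Proof.
intros Hy H; destruct (Rle_or_lt x y) as [|Hlt]; [assumption|].
pose proof (cosh_lt y x Hy Hlt); lra.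
Qed.

Lemma cosh_inj (x y : R) : 0 <= x -> 0 <= y -> cosh x = cosh y -> x = y.
Proof. intros Hx Hy H; apply Rle_antisym; apply cosh_le_inv; lra. Qed.

(** * Lower bounds for the lengths of paths *)

Lemma H2_ext (p q : H2) : re p = re q -> im p = im q -> p = q.
Proof.
destruct p as [x y hy], q as [x' y' hy']; simpl; intros -> ->.
f_equal; apply proof_irrelevance.
Qed.

Definition speed (g : R -> H2) (t : R) : R :=
  sqrt ((Derive (fun u => re (g u)) t) ^ 2 +
        (Derive (fun u => im (g u)) t) ^ 2) / im (g t).

Lemma continuous_mul (f g : R -> R) (t : R) :
  continuous f t -> continuous g t -> continuous (fun s => f s * g s) t.
Proof. intros Hf Hg; exact (continuous_mult f g t Hf Hg). Qed.

Lemma continuous_add (f g : R -> R) (t : R) :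
  continuous f t -> continuous g t -> continuous (fun s => f s + g s) t.
Proof. intros Hf Hg; exact (continuous_plus f g t Hf Hg). Qed.

Lemma continuous_quot (f g : R -> R) (t : R) :
  continuous f t -> continuous g t -> g t <> 0 -> continuous (fun s => f s / g s) t.
Proof.
intros Hf Hg H0; apply continuous_mul; [exact Hf|].
now apply (continuous_comp g Rinv); [|apply continuous_Rinv].
Qed.

Lemma continuous_sq (f : R -> R) (t : R) :
  continuous f t -> continuous (fun s => f s ^ 2) t.
Proof.
intros Hf; apply (continuous_ext (fun s => f s * f s)).
- intros s; change (f s * f s = f s ^ 2); ring.
- now apply continuous_mul.
Qed.

Lemma speed_continuous (g : R -> H2) (p q : H2) (t : R) :
  C1_path g p q -> 0 <= t <= 1 -> continuous (speed g) t.
Proof.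
intros (_ & _ & Hg) Ht; destruct (Hg t Ht) as [[Hx Hy] [Hx' Hy']].
apply continuous_quot.
- apply continuous_comp; [|apply continuous_sqrt].
  now apply continuous_add; apply continuous_sq.
- now apply (ex_derive_continuous (fun u => im (g u))).
- pose proof (im_pos (g t)); lra.
Qed.

(** A function whose derivative along the path is bounded by the speed cannot
    vary by more than the length. *)
Lemma potential_le_length (g : R -> H2) (p q : H2) (u du : R -> R) :
  C1_path g p q ->
  (forall t, 0 <= t <= 1 -> is_derive u t (du t)) ->
  (forall t, 0 <= t <= 1 -> continuous du t) ->
  (forall t, 0 <= t <= 1 -> Rabs (du t) <= speed g t) ->
  Rabs (u 1 - u 0) <= hyp_length g.
Proof.
intros Hg Hu Hc Hle.
assert (Hm : Rmin 0 1 = 0) by (apply Rmin_left; lra).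
assert (HM : Rmax 0 1 = 1) by (apply Rmax_right; lra).
apply (norm_RInt_le du (speed g) 0 1); [lra | exact Hle | |].
- apply (is_RInt_derive u du); rewrite Hm, HM; assumption.
- apply (RInt_correct (speed g)), (ex_RInt_continuous (speed g)).
  rewrite Hm, HM; intros t Ht; now apply (speed_continuous g p q).
Qed.

(** [ln |z - al|].  It is arc length along the vertical geodesic above [al], and
    the difference of two of them is arc length along the semicircular geodesic
    joining their base points. *)
Definition log_potential (al : R) (z : H2) : R :=
  ln ((re z - al) ^ 2 + im z ^ 2) / 2.

(** The derivative of [log_potential al] along [g]. *)
Definition log_slope (al : R) (g : R -> H2) (t : R) : R :=
  ((re (g t) - al) * Derive (fun u => re (g u)) t +
   im (g t) * Derive (fun u => im (g u)) t) /
  ((re (g t) - al) ^ 2 + im (g t) ^ 2).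

Lemma sq_dist_pos (al : R) (z : H2) : 0 < (re z - al) ^ 2 + im z ^ 2.
Proof.
pose proof (pow_lt (im z) 2 (im_pos z)); pose proof (pow2_ge_0 (re z - al)); lra.
Qed.

Lemma is_derive_half_ln_sq_add_sq (x y : R -> R) (al t : R) :
  ex_derive x t -> ex_derive y t -> 0 < (x t - al) ^ 2 + y t ^ 2 ->
  is_derive (fun s => ln ((x s - al) ^ 2 + y s ^ 2) / 2) t
    (((x t - al) * Derive x t + y t * Derive y t) / ((x t - al) ^ 2 + y t ^ 2)).
Proof.
intros Hx Hy HA; auto_derive.
- repeat split; try assumption; simpl in *; lra.
- simpl in *; change (fun s => x s) with x; change (fun s => y s) with y; field; lra.
Qed.

Lemma log_potential_derive (al : R) (g : R -> H2) (p q : H2) (t : R) :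
  C1_path g p q -> 0 <= t <= 1 ->
  is_derive (fun s => log_potential al (g s)) t (log_slope al g t).
Proof.
intros (_ & _ & Hg) Ht; destruct (Hg t Ht) as [[Hx Hy] _].
apply (is_derive_half_ln_sq_add_sq (fun s => re (g s)) (fun s => im (g s)));
  auto using sq_dist_pos.
Qed.

Lemma log_slope_continuous (al : R) (g : R -> H2) (p q : H2) (t : R) :
  C1_path g p q -> 0 <= t <= 1 -> continuous (log_slope al g) t.
Proof.
intros (_ & _ & Hg) Ht; destruct (Hg t Ht) as [[Hx Hy] [Hx' Hy']].
apply (ex_derive_continuous (fun u => im (g u))) in Hy.
assert (Hxa : continuous (fun s => re (g s) - al) t).
{ apply (continuous_add (fun s => re (g s)) (fun _ => - al)); [|apply continuous_const].
  now apply (ex_derive_continuous (fun u => re (g u))). }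
apply continuous_quot.
- now apply continuous_add; apply continuous_mul.
- now apply continuous_add; apply continuous_sq.
- pose proof (sq_dist_pos al (g t)); lra.
Qed.

(** Cauchy-Schwarz: a covector [(v, w)] at height [y] has hyperbolic norm
    [y * sqrt (v ^ 2 + w ^ 2)]. *)
Lemma covector_le_speed (v w x' y' y : R) :
  0 < y -> (v ^ 2 + w ^ 2) * y ^ 2 <= 1 ->
  Rabs (v * x' + w * y') <= sqrt (x' ^ 2 + y' ^ 2) / y.
Proof.
intros Hy H.
apply (Rmult_le_reg_r y); [assumption|].
replace (sqrt (x' ^ 2 + y' ^ 2) / y * y) with (sqrt (x' ^ 2 + y' ^ 2)) by (field; lra).
rewrite <- (Rabs_pos_eq y) at 1 by lra.
rewrite <- Rabs_mult, <- sqrt_Rsqr_abs.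
apply sqrt_le_1_alt; unfold Rsqr.
(* Lagrange's identity *)
assert (((v * x' + w * y') * y) * ((v * x' + w * y') * y)
  = (v ^ 2 + w ^ 2) * y ^ 2 * (x' ^ 2 + y' ^ 2) - (v * y' - w * x') ^ 2 * y ^ 2) by ring.
pose proof (pow2_ge_0 ((v * y' - w * x') * y)).
assert (0 <= x' ^ 2 + y' ^ 2) by nra.
nra.
Qed.

(** The gradient of [ln |z - al|] has hyperbolic norm [im z / |z - al| <= 1]. *)
Lemma log_potential_le_length (al : R) (g : R -> H2) (p q : H2) :
  C1_path g p q ->
  Rabs (log_potential al q - log_potential al p) <= hyp_length g.
Proof.
intros Hg; pose proof Hg as (<- & <- & _).
apply (potential_le_length g (g 0) (g 1) (fun s => log_potential al (g s)) (log_slope al g) Hg).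
- intros t Ht; now apply (log_potential_derive al g (g 0) (g 1)).
- intros t Ht; now apply (log_slope_continuous al g (g 0) (g 1)).
- intros t _; unfold log_slope, speed.
  pose proof (sq_dist_pos al (g t)) as HA; pose proof (im_pos (g t)) as Hy.
  set (A := (re (g t) - al) ^ 2 + im (g t) ^ 2) in *.
  set (x' := Derive _ t); set (y' := Derive _ t).
  replace (((re (g t) - al) * x' + im (g t) * y') / A)
    with ((re (g t) - al) / A * x' + im (g t) / A * y') by (field; lra).
  apply covector_le_speed; [assumption|].
  replace ((((re (g t) - al) / A) ^ 2 + (im (g t) / A) ^ 2) * im (g t) ^ 2)
    with (im (g t) ^ 2 / A) by (unfold A in *; field; lra).
  apply Rle_div_l; [assumption|].
  pose proof (pow2_ge_0 (re (g t) - al)); unfold A; lra.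
Qed.

(** The gradient of [ln (|z - al| / |z - be|)] has hyperbolic norm
    [|al - be| * im z / (|z - al| * |z - be|)], which is the sine of the angle
    under which the segment from [al] to [be] is seen from [z]. *)
Lemma log_ratio_le_length (al be : R) (g : R -> H2) (p q : H2) :
  C1_path g p q ->
  Rabs ((log_potential al q - log_potential be q)
        - (log_potential al p - log_potential be p)) <= hyp_length g.
Proof.
intros Hg; pose proof Hg as (<- & <- & _).
apply (potential_le_length g (g 0) (g 1)
  (fun s => log_potential al (g s) - log_potential be (g s))
  (fun t => log_slope al g t - log_slope be g t) Hg).
- intros t Ht.
  apply (is_derive_minus (fun s => log_potential al (g s)) (fun s => log_potential be (g s)));
    now apply (log_potential_derive _ g (g 0) (g 1)).
- intros t Ht; apply (continuous_minus (log_slope al g) (log_slope be g));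
    now apply (log_slope_continuous _ g (g 0) (g 1)).
- intros t _; unfold log_slope, speed.
  pose proof (sq_dist_pos al (g t)) as HA; pose proof (sq_dist_pos be (g t)) as HB.
  pose proof (im_pos (g t)) as Hy.
  set (x' := Derive _ t); set (y' := Derive _ t).
  set (x := re (g t)) in *; set (y := im (g t)) in *.
  set (A := (x - al) ^ 2 + y ^ 2) in *; set (B := (x - be) ^ 2 + y ^ 2) in *.
  replace (((x - al) * x' + y * y') / A - ((x - be) * x' + y * y') / B)
    with (((x - al) / A - (x - be) / B) * x' + (y / A - y / B) * y') by (field; lra).
  apply covector_le_speed; [assumption|].
  replace ((((x - al) / A - (x - be) / B) ^ 2 + (y / A - y / B) ^ 2) * y ^ 2)
    with ((al - be) ^ 2 * y ^ 2 / (A * B)) by (unfold A, B in *; field; lra).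
  apply Rle_div_l; [now apply Rmult_lt_0_compat|].
  (* |(z - al) (z - be)^*|^2 is the sum of the squares of the imaginary and
     real parts *)
  assert (A * B = (al - be) ^ 2 * y ^ 2 + ((x - al) * (x - be) + y ^ 2) ^ 2)
    by (unfold A, B; ring).
  pose proof (pow2_ge_0 ((x - al) * (x - be) + y ^ 2)); lra.
Qed.

(** * The distance of the upper half-plane *)

(** A unit-speed curve that lifts a 1-Lipschitz function [phi] isometrically is
    minimizing: the competitors of the infimum have length at least the
    variation of [phi], and the affine reparametrization of the curve to [[0, 1]]
    attains this value. *)
Lemma hyp_dist_calibrated (ga : R -> H2) (vx vy : R -> R) (phi : H2 -> R) :
  (forall s, is_derive (fun u => re (ga u)) s (vx s)) ->
  (forall s, is_derive (fun u => im (ga u)) s (vy s)) ->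
  (forall s, continuous vx s) -> (forall s, continuous vy s) ->
  (forall s, vx s ^ 2 + vy s ^ 2 = im (ga s) ^ 2) ->
  (forall s, phi (ga s) = s) ->
  (forall g p q, C1_path g p q -> Rabs (phi q - phi p) <= hyp_length g) ->
  forall s1 s2, hyp_dist (ga s1) (ga s2) = Rabs (s2 - s1).
Proof.
intros Hx Hy Cx Cy Hunit Hphi Hcal s1 s2.
set (k := s2 - s1).
set (g := fun t => ga (s1 + t * k)).
assert (Haff : forall t, is_derive (fun t => s1 + t * k) t k).
{ intros t; auto_derive; [exact I | ring]. }
assert (Caff : forall t, continuous (fun t => s1 + t * k) t).
{ intros t; apply (ex_derive_continuous (fun t => s1 + t * k)); now exists k. }
assert (Dx : forall t, is_derive (fun u => re (g u)) t (k * vx (s1 + t * k))).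
{ intros t; exact (is_derive_comp (fun u => re (ga u)) _ t _ _ (Hx _) (Haff t)). }
assert (Dy : forall t, is_derive (fun u => im (g u)) t (k * vy (s1 + t * k))).
{ intros t; exact (is_derive_comp (fun u => im (ga u)) _ t _ _ (Hy _) (Haff t)). }
assert (Hg : C1_path g (ga s1) (ga s2)).
{ split; [|split].
  - unfold g; f_equal; ring.
  - unfold g, k; f_equal; ring.
  - intros t _; split; split.
    + eexists; apply Dx.
    + eexists; apply Dy.
    + apply (continuous_ext (fun t => k * vx (s1 + t * k))).
      { intros u; symmetry; apply is_derive_unique, Dx. }
      apply continuous_mul; [apply continuous_const|].
      apply (continuous_comp (fun t => s1 + t * k) vx); auto.
    + apply (continuous_ext (fun t => k * vy (s1 + t * k))).
      { intros u; symmetry; apply is_derive_unique, Dy. }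
      apply continuous_mul; [apply continuous_const|].
      apply (continuous_comp (fun t => s1 + t * k) vy); auto. }
assert (Hlen : hyp_length g = Rabs k).
{ unfold hyp_length.
  rewrite (RInt_ext _ (fun _ => Rabs k)).
  - rewrite RInt_const; unfold scal; simpl; unfold mult; simpl; ring.
  - intros t _; match goal with |- ?l = ?m => change (@eq R l m) end; cbv beta.
    replace (Derive (fun u => re (g u)) t) with (k * vx (s1 + t * k))
      by (symmetry; apply is_derive_unique, Dx).
    replace (Derive (fun u => im (g u)) t) with (k * vy (s1 + t * k))
      by (symmetry; apply is_derive_unique, Dy).
    pose proof (im_pos (g t)) as Hp.
    replace ((k * vx (s1 + t * k)) ^ 2 + (k * vy (s1 + t * k)) ^ 2)
      with (Rsqr (k * im (g t))).
    + rewrite sqrt_Rsqr_abs, Rabs_mult, (Rabs_pos_eq (im (g t))) by lra; field; lra.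
    + unfold Rsqr; pose proof (Hunit (s1 + t * k)) as H; unfold g.
      transitivity (k ^ 2 * im (ga (s1 + t * k)) ^ 2); [ring|].
      rewrite <- H; ring. }
unfold hyp_dist.
rewrite (is_glb_Rbar_unique _ (Finite (Rabs k))); [reflexivity|]; split.
- intros l (g' & Hg' & ->); simpl; unfold k.
  rewrite <- (Hphi s1) at 1; rewrite <- (Hphi s2) at 1; now apply Hcal.
- intros b Hb; apply Hb; exists g; split; [exact Hg | now rewrite Hlen].
Qed.

(** The complete geodesics, parametrized by arc length. *)
Definition vertical (a s : R) : H2 := mkH2 a (exp s) (exp_pos s).

Definition semicircle (c r : R) (hr : 0 < r) (s : R) : H2 :=
  mkH2 (c + r * (sinh s / cosh s)) (r / cosh s) (Rdiv_lt_0_compat r _ hr (cosh_pos s)).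

Lemma continuous_cosh (s : R) : continuous cosh s.
Proof.
apply (ex_derive_continuous cosh); exists (sinh s).
apply is_derive_Reals, derivable_pt_lim_cosh.
Qed.

Lemma continuous_sinh (s : R) : continuous sinh s.
Proof.
apply (ex_derive_continuous sinh); exists (cosh s).
apply is_derive_Reals, derivable_pt_lim_sinh.
Qed.

Lemma hyp_dist_vertical (a s1 s2 : R) :
  hyp_dist (vertical a s1) (vertical a s2) = Rabs (s2 - s1).
Proof.
apply (hyp_dist_calibrated _ (fun _ => 0) exp (log_potential a)).
- intros s; apply (is_derive_const a).
- intros s; apply is_derive_exp.
- intros s; apply continuous_const.
- intros s; apply (ex_derive_continuous exp); eexists; apply is_derive_exp.
- intros s; simpl; ring.
- intros s; unfold log_potential; simpl.
  replace ((a - a) * ((a - a) * 1) + exp s * (exp s * 1)) with (exp (s + s))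
    by (rewrite exp_plus; ring).
  rewrite ln_exp; field.
- intros g p q; apply log_potential_le_length.
Qed.

Lemma hyp_dist_semicircle (c r : R) (hr : 0 < r) (s1 s2 : R) :
  hyp_dist (semicircle c r hr s1) (semicircle c r hr s2) = Rabs (s2 - s1).
Proof.
apply (hyp_dist_calibrated _ (fun s => r / cosh s ^ 2) (fun s => - (r * sinh s / cosh s ^ 2))
  (fun z => log_potential (c - r) z - log_potential (c + r) z)).
- intros s; unfold semicircle; simpl; pose proof (cosh_pos s).
  auto_derive; [lra|].
  transitivity (r * (cosh s ^ 2 - sinh s ^ 2) / cosh s ^ 2); [field; lra|].
  replace (cosh s ^ 2 - sinh s ^ 2) with 1 by (rewrite cosh_sq; ring); field; lra.
- intros s; unfold semicircle; simpl; pose proof (cosh_pos s).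
  auto_derive; [lra|]; field; lra.
- intros s; pose proof (cosh_pos s).
  apply continuous_quot; [apply continuous_const | apply continuous_sq, continuous_cosh |].
  apply pow_nonzero; lra.
- intros s; pose proof (cosh_pos s).
  apply (continuous_opp (fun s => r * sinh s / cosh s ^ 2)).
  apply continuous_quot; [| apply continuous_sq, continuous_cosh |].
  + apply continuous_mul; [apply continuous_const | apply continuous_sinh].
  + apply pow_nonzero; lra.
- intros s; simpl im; pose proof (cosh_pos s).
  transitivity (r ^ 2 * (1 + sinh s ^ 2) / cosh s ^ 4); [field; lra|].
  rewrite <- cosh_sq; field; lra.
- intros s; unfold log_potential; simpl re; simpl im.
  pose proof (cosh_pos s) as Hc; pose proof (exp_pos s); pose proof (exp_pos (- s)).
  assert (Hone : cosh s ^ 2 - sinh s ^ 2 = 1) by (rewrite cosh_sq; ring).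
  assert (Hden : 0 < 2 * r ^ 2 / cosh s).
  { apply Rdiv_lt_0_compat; [|assumption]; pose proof (pow_lt r 2 hr); lra. }
  replace ((c + r * (sinh s / cosh s) - (c - r)) ^ 2 + (r / cosh s) ^ 2)
    with (2 * r ^ 2 / cosh s * exp s).
  2:{ transitivity (r ^ 2 * ((sinh s + cosh s) ^ 2 + (cosh s ^ 2 - sinh s ^ 2)) / cosh s ^ 2).
      - replace (exp s) with (sinh s + cosh s) by (unfold sinh, cosh; field); field; lra.
      - rewrite Hone; field; lra. }
  replace ((c + r * (sinh s / cosh s) - (c + r)) ^ 2 + (r / cosh s) ^ 2)
    with (2 * r ^ 2 / cosh s * exp (- s)).
  2:{ transitivity (r ^ 2 * ((sinh s - cosh s) ^ 2 + (cosh s ^ 2 - sinh s ^ 2)) / cosh s ^ 2).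
      - replace (exp (- s)) with (cosh s - sinh s) by (unfold sinh, cosh; field); field; lra.
      - rewrite Hone; field; lra. }
  rewrite !ln_mult, !ln_exp by assumption; field.
- intros g p q Hg.
  replace (_ - _ - (_ - _)) with ((log_potential (c - r) q - log_potential (c + r) q)
        - (log_potential (c - r) p - log_potential (c + r) p)) by ring.
  now apply log_ratio_le_length.
Qed.

Lemma semicircle_through (c r : R) (hr : 0 < r) (p : H2) :
  (re p - c) ^ 2 + im p ^ 2 = r ^ 2 -> exists s, p = semicircle c r hr s.
Proof.
intros Hp; pose proof (im_pos p) as Hy.
exists (arcsinh ((re p - c) / im p)).
set (s := arcsinh ((re p - c) / im p)).
assert (Hs : sinh s = (re p - c) / im p) by apply sinh_arcsinh.
assert (Hc : cosh s = r / im p).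
{ pose proof (cosh_sq s) as H; pose proof (cosh_pos s); rewrite Hs in H.
  apply Rsqr_inj; [lra | left; now apply Rdiv_lt_0_compat |].
  unfold Rsqr; replace (r / im p * (r / im p)) with (r ^ 2 / im p ^ 2) by (field; lra).
  rewrite <- Hp; transitivity (cosh s ^ 2); [ring|]; rewrite H; field; lra. }
apply H2_ext; simpl; rewrite ?Hs, Hc; field; lra.
Qed.

(** Two points lie on a common geodesic: the vertical line if their real parts
    agree, and otherwise the semicircle whose centre [c] is the real point at
    equal Euclidean distance from both. *)
Lemma hyp_dist_spec (p q : H2) :
  0 <= hyp_dist p q /\
  cosh (hyp_dist p q)
  = 1 + ((re p - re q) ^ 2 + (im p - im q) ^ 2) / (2 * im p * im q).
Proof.
destruct (Req_dec (re p) (re q)) as [E | N].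
- assert (Hv : forall z, z = vertical (re z) (ln (im z))).
  { intros z; apply H2_ext; simpl; [reflexivity|]; rewrite exp_ln; [reflexivity | apply im_pos]. }
  replace (hyp_dist p q) with (Rabs (ln (im q) - ln (im p))).
  2:{ rewrite <- (hyp_dist_vertical (re p)); f_equal; [| rewrite E]; symmetry; apply Hv. }
  split; [apply Rabs_pos|].
  rewrite cosh_abs, E.
  pose proof (im_pos p) as Hp; pose proof (im_pos q) as Hq.
  unfold cosh; replace (- (ln (im q) - ln (im p))) with (ln (im p) - ln (im q)) by ring.
  unfold Rminus at 1 2; rewrite !exp_plus, !exp_Ropp, !exp_ln by assumption; field; lra.
- set (c := (re q ^ 2 + im q ^ 2 - re p ^ 2 - im p ^ 2) / (2 * (re q - re p))).
  assert (Hr2 : 0 < (re p - c) ^ 2 + im p ^ 2) by apply sq_dist_pos.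
  set (r := sqrt ((re p - c) ^ 2 + im p ^ 2)).
  assert (hr : 0 < r) by now apply sqrt_lt_R0.
  assert (Er : (re p - c) ^ 2 + im p ^ 2 = r ^ 2) by (symmetry; apply pow2_sqrt; lra).
  assert (Er' : (re q - c) ^ 2 + im q ^ 2 = r ^ 2).
  { assert (Hc : c * (2 * (re q - re p)) = re q ^ 2 + im q ^ 2 - re p ^ 2 - im p ^ 2)
      by (unfold c; field; lra).
    rewrite <- Er; lra. }
  clearbody r; clearbody c.
  destruct (semicircle_through c r hr p Er) as [s1 ->].
  destruct (semicircle_through c r hr q Er') as [s2 ->].
  rewrite hyp_dist_semicircle; split; [apply Rabs_pos|].
  rewrite cosh_abs; unfold Rminus at 1; rewrite cosh_add, cosh_opp, sinh_opp; simpl re; simpl im.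
  pose proof (cosh_pos s1) as H1; pose proof (cosh_pos s2) as H2.
  assert (K : (sinh s1 * cosh s2 - sinh s2 * cosh s1) ^ 2 + (cosh s2 - cosh s1) ^ 2
    = 2 * cosh s1 * cosh s2 * (cosh s1 * cosh s2 - sinh s1 * sinh s2 - 1)).
  { pose proof (cosh_sq s1) as E1; pose proof (cosh_sq s2) as E2.
    transitivity (cosh s2 ^ 2 * (1 + sinh s1 ^ 2) + cosh s1 ^ 2 * (1 + sinh s2 ^ 2)
      - 2 * cosh s1 * cosh s2 * (sinh s1 * sinh s2 + 1)); [ring|].
    rewrite <- E1, <- E2; ring. }
  transitivity (1 + ((sinh s1 * cosh s2 - sinh s2 * cosh s1) ^ 2 + (cosh s2 - cosh s1) ^ 2)
    / (2 * cosh s1 * cosh s2)); [rewrite K|]; field; lra.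
Qed.

(** * Ptolemy's inequality *)
Lemma nonneg_sq_inj (u v : R) : 0 <= u -> 0 <= v -> u ^ 2 = v ^ 2 -> u = v.
Proof. intros Hu Hv H; apply Rsqr_inj; [assumption | assumption | unfold Rsqr; lra]. Qed.

Lemma hyp_dist_sym (p q : H2) : hyp_dist p q = hyp_dist q p.
Proof.
destruct (hyp_dist_spec p q) as [H1 E1], (hyp_dist_spec q p) as [H2 E2].
apply cosh_inj; [assumption | assumption |]; rewrite E1, E2.
pose proof (im_pos p); pose proof (im_pos q); field; lra.
Qed.

Definition pt (p : H2) : C := (re p, im p).

(** The factor contributed by each point when Euclidean distances are compared
    with [sinh] and [cosh] of half the hyperbolic distance; the factor [2] under
    the root makes the comparison exact. *)
Definition weight (p : H2) : R := sqrt (2 * im p).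

Lemma weight_pos (p : H2) : 0 < weight p.
Proof. apply sqrt_lt_R0; pose proof (im_pos p); lra. Qed.

Lemma Cmod_sq (z : C) : Cmod z ^ 2 = fst z ^ 2 + snd z ^ 2.
Proof.
apply pow2_sqrt; pose proof (pow2_ge_0 (fst z)); pose proof (pow2_ge_0 (snd z)); lra.
Qed.

Lemma weight_sq (p : H2) : weight p ^ 2 = 2 * im p.
Proof. apply pow2_sqrt; pose proof (im_pos p); lra. Qed.

Lemma sinh_half_dist (p q : H2) :
  Cmod (pt p - pt q) = sinh (hyp_dist p q / 2) * (weight p * weight q).
Proof.
destruct (hyp_dist_spec p q) as [H E].
pose proof (weight_pos p) as Wp; pose proof (weight_pos q) as Wq.
apply nonneg_sq_inj.
- apply Cmod_ge_0.
- apply Rmult_le_pos; [apply sinh_nonneg; lra|]; apply Rmult_le_pos; lra.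
- rewrite !Rpow_mult_distr, !weight_sq, Cmod_sq.
  replace (sinh (hyp_dist p q / 2) ^ 2) with ((cosh (hyp_dist p q) - 1) / 2)
    by (rewrite cosh_double_sinh; field).
  rewrite E; simpl; pose proof (im_pos p); pose proof (im_pos q); field; lra.
Qed.

(** The distance to the mirror image in the real axis plays the role of [cosh]. *)
Lemma cosh_half_dist (p q : H2) :
  Cmod (pt p - Cconj (pt q)) = cosh (hyp_dist p q / 2) * (weight p * weight q).
Proof.
destruct (hyp_dist_spec p q) as [H E].
pose proof (weight_pos p) as Wp; pose proof (weight_pos q) as Wq.
apply nonneg_sq_inj.
- apply Cmod_ge_0.
- apply Rmult_le_pos; [left; apply cosh_pos|]; apply Rmult_le_pos; lra.
- rewrite !Rpow_mult_distr, !weight_sq, Cmod_sq.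
  replace (cosh (hyp_dist p q / 2) ^ 2) with ((cosh (hyp_dist p q) + 1) / 2)
    by (rewrite cosh_double_cosh; field).
  rewrite E; simpl; pose proof (im_pos p); pose proof (im_pos q); field; lra.
Qed.

Lemma Cmod_conj_swap (z w : C) : Cmod (Cconj z - w) = Cmod (w - Cconj z).
Proof. rewrite <- Cmod_opp; f_equal; ring. Qed.

(** The triangle inequality applied to
    [(a - c) (b - d) = (a - b) (c - d) + (b - c) (a - d)]. *)
Lemma ptolemy_C (a b c d : C) :
  Cmod (a - c) * Cmod (b - d) <= Cmod (a - b) * Cmod (c - d) + Cmod (b - c) * Cmod (a - d).
Proof.
rewrite <- !Cmod_mult.
replace ((a - c) * (b - d))%C with ((a - b) * (c - d) + (b - c) * (a - d))%C by ring.
apply Cmod_triangle.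
Qed.

(** Conjugating [c, d] in the complex inequality yields the products
    [sinh sinh + cosh cosh], conjugating [b, c] yields [cosh cosh + sinh sinh]:
    the choices are such that the two left-hand sides agree and the right-hand
    sides add up to addition formulas. *)
Lemma cosh_ptolemy (a b c d : H2) :
  2 * (cosh (hyp_dist a c / 2) * cosh (hyp_dist b d / 2))
  <= cosh ((hyp_dist a b + hyp_dist c d) / 2) + cosh ((hyp_dist b c + hyp_dist a d) / 2).
Proof.
pose proof (ptolemy_C (pt a) (pt b) (Cconj (pt c)) (Cconj (pt d))) as H1.
pose proof (ptolemy_C (pt a) (Cconj (pt b)) (Cconj (pt c)) (pt d)) as H2.
rewrite <- Cminus_conj, Cmod_conj in H1.
rewrite <- Cminus_conj, Cmod_conj, (Cmod_conj_swap (pt b) (pt d)),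
  (Cmod_conj_swap (pt c) (pt d)) in H2.
rewrite !sinh_half_dist, !cosh_half_dist in *.
rewrite (hyp_dist_sym d b), (hyp_dist_sym d c) in *.
replace ((hyp_dist a b + hyp_dist c d) / 2) with (hyp_dist a b / 2 + hyp_dist c d / 2) by field.
replace ((hyp_dist b c + hyp_dist a d) / 2) with (hyp_dist b c / 2 + hyp_dist a d / 2) by field.
rewrite !cosh_add.
pose proof (weight_pos a); pose proof (weight_pos b).
pose proof (weight_pos c); pose proof (weight_pos d).
apply (Rmult_le_reg_r (weight a * weight b * (weight c * weight d)));
  [repeat apply Rmult_lt_0_compat; assumption | lra].
Qed.

(** * The value of Gamma *)

(** The side of the regular quadrilateral with diagonals of length [x]. *)
Definition square_side (x : R) : R := 2 * arcsinh (sinh (x / 2) / sqrt 2).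

Lemma sqrt2_pos : 0 < sqrt 2.
Proof. apply sqrt_lt_R0; lra. Qed.

Lemma cosh_square_side (x : R) : cosh (square_side x) = cosh (x / 2) ^ 2.
Proof.
rewrite cosh_double_sinh; unfold square_side.
replace (2 * arcsinh (sinh (x / 2) / sqrt 2) / 2) with (arcsinh (sinh (x / 2) / sqrt 2)) by field.
pose proof sqrt2_pos.
rewrite sinh_arcsinh, cosh_sq.
replace ((sinh (x / 2) / sqrt 2) ^ 2) with (sinh (x / 2) ^ 2 / sqrt 2 ^ 2) by (field; lra).
rewrite pow2_sqrt by lra; field.
Qed.

Lemma square_side_nonneg (x : R) : 0 <= x -> 0 <= square_side x.
Proof.
intros Hx; unfold square_side; apply Rmult_le_pos; [lra|]; rewrite <- arcsinh_0.
apply arcsinh_le, Rmult_le_pos; [apply sinh_nonneg; lra|].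
left; apply Rinv_0_lt_compat, sqrt2_pos.
Qed.

(** Expanding both sides in [t], this needs [cosh P * sinh Q <= sinh m], which
    follows from the hypothesis by squaring because [1 <= cosh P]. *)
Lemma cosh_mul_cosh_shift (P Q m t : R) :
  0 <= Q -> 0 <= m -> 0 <= t -> cosh P * cosh Q <= cosh m ->
  cosh P * cosh (Q + t) <= cosh (m + t).
Proof.
intros HQ Hm Ht H.
pose proof (cosh_pos P) as HP; pose proof (cosh_ge_1 P) as HP1; pose proof (cosh_pos Q) as HcQ.
pose proof (sinh_nonneg Q HQ) as HsQ; pose proof (sinh_nonneg m Hm) as Hsm.
assert (Hs : cosh P * sinh Q <= sinh m).
{ assert (H2 : (cosh P * cosh Q) ^ 2 <= cosh m ^ 2).
  { apply pow_incr; split; [apply Rmult_le_pos; lra | assumption]. }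
  rewrite Rpow_mult_distr, (cosh_sq m), (cosh_sq Q) in H2.
  apply Rsqr_incr_0; [| now apply Rmult_le_pos; [left|] | assumption].
  pose proof (pow_incr 1 (cosh P) 2 ltac:(lra)); unfold Rsqr; lra. }
rewrite !cosh_add.
pose proof (sinh_nonneg t Ht) as Hst; pose proof (cosh_pos t) as Hct.
apply Rmult_le_compat_r with (r := cosh t) in H; [|lra].
apply Rmult_le_compat_r with (r := sinh t) in Hs; [|lra].
lra.
Qed.

(** The excess [p + q - M] is unchanged when [p] and [M], or [q] and [M], are
    lengthened by the same amount, so the case [p = q = x] decides. *)
Lemma gap_le (p q x M : R) :
  0 <= p <= x -> 0 <= q <= x -> 0 <= M ->
  cosh (p / 2) * cosh (q / 2) <= cosh (M / 2) ->
  p + q - M <= 2 * (x - square_side x).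
Proof.
intros Hp Hq HM H.
apply (cosh_mul_cosh_shift _ _ _ ((x - q) / 2)) in H; [|lra..].
rewrite Rmult_comm in H.
apply (cosh_mul_cosh_shift _ _ _ ((x - p) / 2)) in H; [|lra..].
replace (q / 2 + (x - q) / 2) with (x / 2) in H by field.
replace (p / 2 + (x - p) / 2) with (x / 2) in H by field.
replace (cosh (x / 2) * cosh (x / 2)) with (cosh (square_side x)) in H
  by (rewrite cosh_square_side; ring).
apply cosh_le_inv in H; lra.
Qed.

Lemma diagonals_gap_le (a b c d : H2) (x : R) :
  hyp_dist a c <= x -> hyp_dist b d <= x ->
  hyp_dist a c + hyp_dist b d
  - Rmax (hyp_dist a b + hyp_dist c d) (hyp_dist b c + hyp_dist a d)
  <= 2 * (x - square_side x).
Proof.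
intros Hp Hq.
destruct (hyp_dist_spec a c) as [Hac _], (hyp_dist_spec b d) as [Hbd _].
destruct (hyp_dist_spec a b) as [Hab _], (hyp_dist_spec c d) as [Hcd _].
destruct (hyp_dist_spec b c) as [Hbc _], (hyp_dist_spec a d) as [Had _].
pose proof (cosh_ptolemy a b c d) as H.
set (s := hyp_dist a b + hyp_dist c d) in *; set (s' := hyp_dist b c + hyp_dist a d) in *.
pose proof (Rmax_l s s'); pose proof (Rmax_r s s').
assert (0 <= s) by (unfold s; lra); assert (0 <= s') by (unfold s'; lra).
apply gap_le; [lra..|].
assert (cosh (s / 2) <= cosh (Rmax s s' / 2)) by (apply cosh_le; lra).
assert (cosh (s' / 2) <= cosh (Rmax s s' / 2)) by (apply cosh_le; lra).
lra.
Qed.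

(** The largest of three numbers exceeds the middle one by what it exceeds the
    maximum of the other two. *)
Lemma max_sub_middle_le (r s t k : R) :
  r - Rmax s t <= k -> s - Rmax r t <= k -> t - Rmax r s <= k ->
  Rmax (Rmax r s) t - middle r s t <= k.
Proof.
unfold middle, Rmax, Rmin; intros H1 H2 H3.
repeat match goal with
| H : context [Rle_dec ?u ?v] |- _ => destruct (Rle_dec u v)
| |- context [Rle_dec ?u ?v] => destruct (Rle_dec u v)
end; lra.
Qed.

Lemma diam4_le {X : Type} (d : X -> X -> R) (a b c e : X) (x : R) :
  diam4 d a b c e <= x ->
  d a b <= x /\ d a c <= x /\ d a e <= x /\ d b c <= x /\ d b e <= x /\ d c e <= x.
Proof.
unfold diam4; intros H.
repeat split; eapply Rle_trans; try exact H.
all: rewrite ?Rmax_Rle; auto using Rle_refl.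
Qed.

Lemma delta4_le (a b c e : H2) (x : R) :
  diam4 hyp_dist a b c e = x -> delta4 hyp_dist a b c e <= x - square_side x.
Proof.
intros H; apply Req_le, diam4_le in H as (Hab & Hac & Hae & Hbc & Hbe & Hce).
unfold delta4.
match goal with |- ?g / 2 <= _ => enough (g <= 2 * (x - square_side x)) by lra end.
apply max_sub_middle_le.
- pose proof (diagonals_gap_le a c b e x Hab Hce) as H.
  rewrite (hyp_dist_sym c b) in H; now rewrite (Rplus_comm (hyp_dist b c)) in H.
- pose proof (diagonals_gap_le a b c e x Hac Hbe) as H.
  now rewrite (Rplus_comm (hyp_dist b c)) in H.
- pose proof (diagonals_gap_le a b e c x Hae Hbc) as H.
  rewrite (hyp_dist_sym e c) in H; now rewrite (Rplus_comm (hyp_dist b e)) in H.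
Qed.

(** The regular quadrilateral is centred at [i], with one diagonal on the
    imaginary axis and the other on the unit circle. *)
Lemma square_quadruple (x : R) :
  0 <= x -> exists a b c e : H2,
    diam4 hyp_dist a b c e = x /\ delta4 hyp_dist a b c e = x - square_side x.
Proof.
intros Hx; set (h := x / 2).
exists (vertical 0 h), (semicircle 0 1 Rlt_0_1 h),
  (vertical 0 (- h)), (semicircle 0 1 Rlt_0_1 (- h)).
assert (Hh : Rabs (- h - h) = x).
{ unfold h; replace (- (x / 2) - x / 2) with (- x) by field.
  rewrite Rabs_Ropp; now apply Rabs_pos_eq. }
assert (Hs : forall s t, s ^ 2 = h ^ 2 -> t ^ 2 = h ^ 2 ->
  hyp_dist (vertical 0 s) (semicircle 0 1 Rlt_0_1 t) = square_side x).
{ intros s t Es Et.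
  (* s and t are h up to sign *)
  assert (Cs : forall u, u ^ 2 = h ^ 2 -> cosh u = cosh h).
  { intros u Eu; rewrite <- (cosh_abs u), <- (cosh_abs h); f_equal.
    rewrite <- !sqrt_Rsqr_abs; f_equal; unfold Rsqr; lra. }
  destruct (hyp_dist_spec (vertical 0 s) (semicircle 0 1 Rlt_0_1 t)) as [Hpos E].
  apply cosh_inj; [assumption | now apply square_side_nonneg |].
  rewrite E, cosh_square_side; fold h; simpl re; simpl im.
  pose proof (exp_pos s) as Hexp; pose proof (cosh_pos t) as Ht.
  transitivity ((exp s ^ 2 * cosh t ^ 2 + (1 + sinh t ^ 2)) / (2 * exp s * cosh t)).
  { field; lra. }
  rewrite <- cosh_sq.
  transitivity ((exp s + / exp s) / 2 * cosh t); [field; lra|].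
  rewrite <- exp_Ropp; change ((exp s + exp (- s)) / 2) with (cosh s).
  rewrite (Cs s Es), (Cs t Et); ring. }
assert (E0 : h ^ 2 = h ^ 2) by reflexivity.
assert (E1 : (- h) ^ 2 = h ^ 2) by ring.
assert (Hsx : square_side x <= x).
{ apply cosh_le_inv; [assumption|]; rewrite cosh_square_side, (cosh_double_cosh x).
  pose proof (cosh_ge_1 (x / 2)).
  pose proof (pow_incr 1 (cosh (x / 2)) 2 ltac:(lra)); lra. }
unfold diam4, delta4.
rewrite hyp_dist_vertical, hyp_dist_semicircle, Hh.
rewrite (hyp_dist_sym (semicircle 0 1 Rlt_0_1 h)), !Hs by assumption.
split.
- rewrite (Rmax_right (square_side x) x), (Rmax_left x (square_side x)), Rmax_left
    by lra; reflexivity.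
- unfold middle.
  rewrite (Rmax_right (square_side x + _) (x + x)) by lra.
  rewrite (Rmin_left (square_side x + _) (x + x)) by lra.
  rewrite (Rmax_left (x + x)), (Rmin_right (x + x)), Rmax_left by lra; lra.
Qed.

Lemma Gamma_hyp_dist (x : R) : 0 <= x -> Gamma hyp_dist x = x - square_side x.
Proof.
intros Hx; unfold Gamma.
rewrite (is_lub_Rbar_unique _ (Finite (x - square_side x))); [reflexivity|]; split.
- intros r (a & b & c & e & Hd & ->); now apply delta4_le.
- intros u Hu; destruct (square_quadruple x Hx) as (a & b & c & e & Hd & He).
  apply Hu; exists a, b, c, e; now rewrite He.
Qed.

(** * The derivative of Gamma *)
Definition dGamma (x : R) : R :=
  1 - cosh (x / 2) / (sqrt 2 * sqrt ((sinh (x / 2) / sqrt 2) ^ 2 + 1)).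

Lemma is_derive_sub_square_side (x : R) :
  is_derive (fun t => t - square_side t) x (dGamma x).
Proof.
unfold square_side, dGamma; pose proof sqrt2_pos as H2.
set (w := sqrt ((sinh (x / 2) / sqrt 2) ^ 2 + 1)).
assert (Hw : 0 < w).
{ apply sqrt_lt_R0; pose proof (pow2_ge_0 (sinh (x / 2) / sqrt 2)); lra. }
assert (Hi : is_derive (fun t => sinh (t / 2) / sqrt 2) x (cosh (x / 2) / 2 / sqrt 2)).
{ auto_derive; [exact I|]; unfold Rdiv; ring. }
assert (Ho : is_derive arcsinh (sinh (x / 2) / sqrt 2) (/ w)).
{ apply is_derive_Reals, derivable_pt_lim_arcsinh. }
pose proof (is_derive_comp arcsinh _ x _ _ Ho Hi) as Hc.
pose proof (is_derive_minus _ _ x _ _ (is_derive_id x) (is_derive_scal _ x 2 _ Hc)) as Hm.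
replace (1 - cosh (x / 2) / (sqrt 2 * w))
  with (minus 1 (2 * scal (cosh (x / 2) / 2 / sqrt 2) (/ w))); [exact Hm|].
unfold minus, plus, opp, scal; simpl; unfold mult; simpl; field; lra.
Qed.

Lemma locally_Gamma (x : R) :
  0 < x -> locally x (fun t => t - square_side t = Gamma hyp_dist t).
Proof.
intros Hx; exists (mkposreal x Hx); intros t Ht.
symmetry; apply Gamma_hyp_dist.
unfold ball in Ht; simpl in Ht; unfold AbsRing_ball, abs, minus, plus, opp in Ht; simpl in Ht.
apply Rabs_lt_between in Ht; lra.
Qed.

Lemma is_derive_Gamma (x : R) : 0 < x -> is_derive (Gamma hyp_dist) x (dGamma x).
Proof.
intros Hx; apply (is_derive_ext_loc (fun t => t - square_side t)).
- now apply locally_Gamma.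
- apply is_derive_sub_square_side.
Qed.

Lemma continuous_dGamma_0 : continuous dGamma 0.
Proof.
apply (ex_derive_continuous dGamma); unfold dGamma; pose proof sqrt2_pos.
assert (Hs : 0 < (sinh (0 / 2) / sqrt 2) ^ 2 + 1).
{ pose proof (pow2_ge_0 (sinh (0 / 2) / sqrt 2)); lra. }
auto_derive; split; [|split]; try exact I.
- simpl in *; lra.
- apply Rgt_not_eq, Rmult_lt_0_compat; [assumption|]; apply sqrt_lt_R0; simpl in *; lra.
Qed.

Lemma dGamma_0 : dGamma 0 = (sqrt 2 - 1) / sqrt 2.
Proof.
unfold dGamma; pose proof sqrt2_pos.
replace (0 / 2) with 0 by field; rewrite sinh_0, cosh_0.
replace ((0 / sqrt 2) ^ 2 + 1) with 1 by (field; lra); rewrite sqrt_1; field; lra.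
Qed.

Theorem corollary3p8 :
  (forall x : R, 0 < x -> ex_derive (Gamma hyp_dist) x) /\
  filterlim (Derive (Gamma hyp_dist)) (at_right 0)
    (locally ((sqrt 2 - 1) / sqrt 2)).
Proof.
split.
- intros x Hx; exists (dGamma x); now apply is_derive_Gamma.
- rewrite <- dGamma_0.
  apply (filterlim_ext_loc dGamma).
  + exists (mkposreal 1 Rlt_0_1); intros x _ Hx; symmetry.
    now apply is_derive_unique, is_derive_Gamma.
  + intros P HP; destruct (continuous_dGamma_0 P HP) as [eps He].
    exists eps; intros y Hy _; now apply He.
Qed.
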